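(* Let $N$ be a Nijenhuis operator on a $3$-Hom-L-dendriform algebra $(A,\nwarrow,\nearrow,\alpha)$. Then $N$ is a Nijenhuis operator on its sub-adjacent $3$-Hom-pre-Lie algebras $(A,\{\cdot,\cdot,\cdot\}^h,\alpha)$ and $(A,\{\cdot,\cdot,\cdot\}^v,\alpha)$ and on its sub-adjacent $3$-Hom-Lie algebra $(A,[\cdot,\cdot,\cdot]^C,\alpha)$.
   Context: All vector spaces are over a field $\mathbb K$ of characteristic $0$. A $3$-Hom-L-dendriform algebra is a tuple $(A,\nwarrow,\nearrow,\alpha)$ where $A$ is a vector space, $\nwarrow,\nearrow:\otimes^3A\to A$ and $\alpha:A\to A$ are linear, $\alpha$ is multiplicative (i.e. $\alpha(\nwarrow(x,y,z))=\nwarrow(\alpha(x),\alpha(y),\alpha(z))$ and likewise for $\nearrow$), and, writing $\{x,y,z\}^h=\nwarrow(x,y,z)+\nearrow(x,y,z)-\nearrow(y,x,z)$, $\{x,y,z\}^v=\nwarrow(x,y,z)+\nearrow(z,x,y)-\nearrow(z,y,x)$, $[x,y,z]^C=\{x,y,z\}^h+\{y,z,x\}^h+\{z,x,y\}^h$ (equal to the same cyclic sum of $\{\cdot,\cdot,\cdot\}^v$), the following hold for all $x_1,\dots,x_5\in A$ (where $\circlearrowleft_{1,2,3}$ is the sum over cyclic permutations of the indices $1,2,3$): (0) $\nwarrow(x_1,x_2,x_3)+\nwarrow(x_2,x_1,x_3)=0$; (1) $\nwarrow(\alpha(x_1),\alpha(x_2),\nwarrow(x_3,x_4,x_5))-\nwarrow(\alpha(x_3),\alpha(x_4),\nwarrow(x_1,x_2,x_5))=\nwarrow([x_1,x_2,x_3]^C,\alpha(x_4),\alpha(x_5))-\nwarrow([x_1,x_2,x_4]^C,\alpha(x_3),\alpha(x_5))$;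 (2) $\nwarrow(\alpha(x_1),\alpha(x_2),\nearrow(x_5,x_3,x_4))-\nearrow(\alpha(x_5),\alpha(x_3),\{x_1,x_2,x_4\}^h)=\nearrow(\alpha(x_5),[x_1,x_2,x_3]^C,\alpha(x_4))+\nearrow(\{x_1,x_2,x_5\}^v,\alpha(x_3),\alpha(x_4))$; (3) $\nearrow(\alpha(x_5),\alpha(x_1),\{x_2,x_3,x_4\}^h)-\nwarrow(\alpha(x_2),\alpha(x_3),\nearrow(x_5,x_1,x_4))=\nearrow(\{x_1,x_2,x_5\}^v,\alpha(x_3),\alpha(x_4))-\nearrow(\{x_1,x_3,x_5\}^v,\alpha(x_2),\alpha(x_4))$; (4) $\nwarrow([x_1,x_2,x_3]^C,\alpha(x_4),\alpha(x_5))=\circlearrowleft_{1,2,3}\nwarrow(\alpha(x_1),\alpha(x_2),\nwarrow(x_3,x_4,x_5))$; (5) $\nearrow(\alpha(x_5),[x_1,x_2,x_3]^C,\alpha(x_4))=\circlearrowleft_{1,2,3}\nwarrow(\alpha(x_1),\alpha(x_2),\nearrow(x_5,x_3,x_4))$; (6) $\nwarrow(\alpha(x_1),\alpha(x_2),\nearrow(x_5,x_3,x_4))+\nearrow(\alpha(x_5),\alpha(x_1),\{x_2,x_3,x_4\}^h)=\nearrow(\alpha(x_5),\alpha(x_2),\{x_1,x_3,x_4\}^h)+\nearrow(\{x_1,x_2,x_5\}^v,\alpha(x_3),\alpha(x_4))$. It is known that $(A,\{\cdot,\cdot,\cdot\}^h,\alpha)$ and $(A,\{\cdot,\cdot,\cdot\}^v,\alpha)$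 are then $3$-Hom-pre-Lie algebras and $(A,[\cdot,\cdot,\cdot]^C,\alpha)$ is a $3$-Hom-Lie algebra. For a trilinear operation $\ast$ on $A$, say that a linear map $N:A\to A$ satisfies the Nijenhuis identity for $\ast$ if for all $x,y,z\in A$ $$\ast(Nx,Ny,Nz)=N\big(\ast(Nx,Ny,z)+\ast(Nx,y,Nz)+\ast(x,Ny,Nz)\big)-N^2\big(\ast(Nx,y,z)+\ast(x,Ny,z)+\ast(x,y,Nz)\big)+N^3\ast(x,y,z).$$ A Nijenhuis operator on a $3$-Hom-L-dendriform algebra is a linear $N$ with $N\alpha=\alpha N$ satisfying the Nijenhuis identity for both $\nwarrow$ and $\nearrow$; a Nijenhuis operator on a $3$-Hom-pre-Lie or $3$-Hom-Lie algebra is a linear $N$ with $N\alpha=\alpha N$ satisfying the Nijenhuis identity for its ternary bracket. *)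

(* Defs.v *)
From HB Require Import structures.
From mathcomp Require Import all_boot all_algebra.

Set Implicit Arguments.
Unset Strict Implicit.
Unset Printing Implicit Defensive.

Import GRing.Theory.
Local Open Scope ring_scope.

Definition ternary_op (A : Type) := A -> A -> A -> A.

Definition trilinear (K : fieldType) (A : lmodType K) (f : ternary_op A) : Prop :=
  [/\ forall y z, linear (fun x => f x y z),
      forall x z, linear (fun y => f x y z)
    & forall x y, linear (fun z => f x y z)].

Definition multiplicative3 (A : Type) (f : ternary_op A) (alpha : A -> A) : Prop :=
  forall x y z, alpha (f x y z) = f (alpha x) (alpha y) (alpha z).

Definition cyclic_sum (A : zmodType) (f : ternary_op A) : ternary_op A :=
  fun x y z => f x y z + f y z x + f z x y.

Definition hbracket (A : zmodType) (nw ne : ternary_op A) : ternary_op A :=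
  fun x y z => nw x y z + ne x y z - ne y x z.

Definition vbracket (A : zmodType) (nw ne : ternary_op A) : ternary_op A :=
  fun x y z => nw x y z + ne z x y - ne z y x.

Definition Cbracket (A : zmodType) (nw ne : ternary_op A) : ternary_op A :=
  cyclic_sum (hbracket nw ne).

(* All three Hom-structures below are the multiplicative ones, over a fixed
   underlying vector space [A]. *)
Record hom3LieAlgebra (K : fieldType) (A : lmodType K) := Hom3LieAlgebra {
  lie_br : ternary_op A;
  lie_alpha : {linear A -> A};
  lie_trilinear : trilinear lie_br;
  lie_mult : multiplicative3 lie_br lie_alpha;
  lie_skew12 : forall x y z, lie_br x y z = - lie_br y x z;
  lie_skew23 : forall x y z, lie_br x y z = - lie_br x z y;
  lie_hom_nambu : forall x1 x2 x3 x4 x5,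
    lie_br (lie_alpha x1) (lie_alpha x2) (lie_br x3 x4 x5) =
      lie_br (lie_br x1 x2 x3) (lie_alpha x4) (lie_alpha x5)
      + lie_br (lie_alpha x3) (lie_br x1 x2 x4) (lie_alpha x5)
      + lie_br (lie_alpha x3) (lie_alpha x4) (lie_br x1 x2 x5)
}.

Record hom3PreLieAlgebra (K : fieldType) (A : lmodType K) := Hom3PreLieAlgebra {
  pl_br : ternary_op A;
  pl_alpha : {linear A -> A};
  pl_trilinear : trilinear pl_br;
  pl_mult : multiplicative3 pl_br pl_alpha;
  pl_skew : forall x y z, pl_br x y z = - pl_br y x z;
  pl_ax1 : forall x1 x2 x3 x4 x5,
    pl_br (pl_alpha x1) (pl_alpha x2) (pl_br x3 x4 x5) =
      pl_br (cyclic_sum pl_br x1 x2 x3) (pl_alpha x4) (pl_alpha x5)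
      + pl_br (pl_alpha x3) (cyclic_sum pl_br x1 x2 x4) (pl_alpha x5)
      + pl_br (pl_alpha x3) (pl_alpha x4) (pl_br x1 x2 x5);
  pl_ax2 : forall x1 x2 x3 x4 x5,
    pl_br (cyclic_sum pl_br x1 x2 x3) (pl_alpha x4) (pl_alpha x5) =
      cyclic_sum (fun a b c => pl_br (pl_alpha a) (pl_alpha b) (pl_br c x4 x5))
        x1 x2 x3
}.

Record hom3LDendriformAlgebra (K : fieldType) (A : lmodType K) :=
    Hom3LDendriformAlgebra {
  ld_nw : ternary_op A;
  ld_ne : ternary_op A;
  ld_alpha : {linear A -> A};
  ld_nw_trilinear : trilinear ld_nw;
  ld_ne_trilinear : trilinear ld_ne;
  ld_nw_mult : multiplicative3 ld_nw ld_alpha;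
  ld_ne_mult : multiplicative3 ld_ne ld_alpha;
  ld_ax0 : forall x1 x2 x3, ld_nw x1 x2 x3 + ld_nw x2 x1 x3 = 0;
  ld_ax1 : forall x1 x2 x3 x4 x5,
    ld_nw (ld_alpha x1) (ld_alpha x2) (ld_nw x3 x4 x5)
    - ld_nw (ld_alpha x3) (ld_alpha x4) (ld_nw x1 x2 x5) =
      ld_nw (Cbracket ld_nw ld_ne x1 x2 x3) (ld_alpha x4) (ld_alpha x5)
      - ld_nw (Cbracket ld_nw ld_ne x1 x2 x4) (ld_alpha x3) (ld_alpha x5);
  ld_ax2 : forall x1 x2 x3 x4 x5,
    ld_nw (ld_alpha x1) (ld_alpha x2) (ld_ne x5 x3 x4)
    - ld_ne (ld_alpha x5) (ld_alpha x3) (hbracket ld_nw ld_ne x1 x2 x4) =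
      ld_ne (ld_alpha x5) (Cbracket ld_nw ld_ne x1 x2 x3) (ld_alpha x4)
      + ld_ne (vbracket ld_nw ld_ne x1 x2 x5) (ld_alpha x3) (ld_alpha x4);
  ld_ax3 : forall x1 x2 x3 x4 x5,
    ld_ne (ld_alpha x5) (ld_alpha x1) (hbracket ld_nw ld_ne x2 x3 x4)
    - ld_nw (ld_alpha x2) (ld_alpha x3) (ld_ne x5 x1 x4) =
      ld_ne (vbracket ld_nw ld_ne x1 x2 x5) (ld_alpha x3) (ld_alpha x4)
      - ld_ne (vbracket ld_nw ld_ne x1 x3 x5) (ld_alpha x2) (ld_alpha x4);
  ld_ax4 : forall x1 x2 x3 x4 x5,
    ld_nw (Cbracket ld_nw ld_ne x1 x2 x3) (ld_alpha x4) (ld_alpha x5) =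
      cyclic_sum (fun a b c => ld_nw (ld_alpha a) (ld_alpha b) (ld_nw c x4 x5))
        x1 x2 x3;
  ld_ax5 : forall x1 x2 x3 x4 x5,
    ld_ne (ld_alpha x5) (Cbracket ld_nw ld_ne x1 x2 x3) (ld_alpha x4) =
      cyclic_sum (fun a b c => ld_nw (ld_alpha a) (ld_alpha b) (ld_ne x5 c x4))
        x1 x2 x3;
  ld_ax6 : forall x1 x2 x3 x4 x5,
    ld_nw (ld_alpha x1) (ld_alpha x2) (ld_ne x5 x3 x4)
    + ld_ne (ld_alpha x5) (ld_alpha x1) (hbracket ld_nw ld_ne x2 x3 x4) =
      ld_ne (ld_alpha x5) (ld_alpha x2) (hbracket ld_nw ld_ne x1 x3 x4)
      + ld_ne (vbracket ld_nw ld_ne x1 x2 x5) (ld_alpha x3) (ld_alpha x4)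
}.

Definition nijenhuis_identity (A : zmodType) (f : ternary_op A) (N : A -> A) : Prop :=
  forall x y z,
    f (N x) (N y) (N z) =
      N (f (N x) (N y) z + f (N x) y (N z) + f x (N y) (N z))
      - N (N (f (N x) y z + f x (N y) z + f x y (N z)))
      + N (N (N (f x y z))).

Definition LDendriform_Nijenhuis (K : fieldType) (A : lmodType K)
    (D : hom3LDendriformAlgebra A) (N : {linear A -> A}) : Prop :=
  [/\ forall x, N (ld_alpha D x) = ld_alpha D (N x),
      nijenhuis_identity (ld_nw D) N
    & nijenhuis_identity (ld_ne D) N].

Definition PreLie_Nijenhuis (K : fieldType) (A : lmodType K)
    (P : hom3PreLieAlgebra A) (N : {linear A -> A}) : Prop :=
  (forall x, N (pl_alpha P x) = pl_alpha P (N x))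
  /\ nijenhuis_identity (pl_br P) N.

Definition Lie_Nijenhuis (K : fieldType) (A : lmodType K)
    (L : hom3LieAlgebra A) (N : {linear A -> A}) : Prop :=
  (forall x, N (lie_alpha L x) = lie_alpha L (N x))
  /\ nijenhuis_identity (lie_br L) N.

(* A reflexive decision procedure for equalities between integral linear
   combinations in an abelian group. *)
Module ZmodNorm.

Inductive expr := Zero | Var of nat | Add of expr & expr | Opp of expr.

Fixpoint eval (A : zmodType) (env : seq A) (t : expr) : A :=
  match t with
  | Zero => 0
  | Var i => env`_i
  | Add a b => eval env a + eval env b
  | Opp a => - eval env a
  end.

Fixpoint coef (i : nat) (t : expr) : int :=
  match t with
  | Zero => 0
  | Var j => (i == j)%:R
  | Add a b => coef i a + coef i b
  | Opp a => - coef i a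
  end.

Lemma evalE (A : zmodType) (env : seq A) (t : expr) :
  eval env t = \sum_(i < size env) env`_i *~ coef i t.
Proof.
elim: t => [|j|a IHa b IHb|a IHa] /=.
- by rewrite big1 // => i _; rewrite mulr0z.
- case: (ltnP j (size env)) => jn; last first.
    rewrite nth_default // big1 // => i _.
    by rewrite (ltn_eqF (leq_trans (ltn_ord i) jn)) mulr0z.
  rewrite (bigD1 (Ordinal jn)) //= eqxx mulr1z big1 ?addr0 // => i.
  by rewrite -val_eqE /= => /negPf ->; rewrite mulr0z.
- by rewrite IHa IHb -big_split; apply: eq_bigr => i _; rewrite mulrzDr.
- by rewrite IHa -sumrN; apply: eq_bigr => i _; rewrite mulrNz.
Qed.

Lemma correct (A : zmodType) (env : seq A) (a b : expr) :
  all (fun i => coef i a == coef i b) (iota 0 (size env)) ->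
  eval env a = eval env b.
Proof.
move=> /allP ab; rewrite !evalE; apply: eq_bigr => i _.
by rewrite (eqP (ab i _)) // mem_iota add0n ltn_ord.
Qed.

Lemma use (A : zmodType) (a b c d : A) : a = b -> c + b = d + a -> c = d.
Proof. by move=> -> /addIr. Qed.

Ltac in_env x l :=
  lazymatch l with
  | nil => constr:(false)
  | ?h :: ?q => match h with x => constr:(true) | _ => in_env x q end
  end.
Ltac collect l t :=
  lazymatch t with
  | (0)%R => l
  | (?a + ?b)%R => let l1 := collect l a in collect l1 b
  | (- ?a)%R => collect l a
  | _ => lazymatch in_env t l with true => l | false => constr:(t :: l) end
  end.
Ltac index x l :=
  match l with
  | x :: _ => constr:(0%N)
  | _ :: ?q => let n := index x q in constr:(S n)
  end.
Ltac reify l t :=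
  lazymatch t with
  | (0)%R => constr:(Zero)
  | (?a + ?b)%R =>
      let a' := reify l a in let b' := reify l b in constr:(Add a' b')
  | (- ?a)%R => let a' := reify l a in constr:(Opp a')
  | _ => let n := index t l in constr:(Var n)
  end.

End ZmodNorm.

Ltac zmod_eq :=
  lazymatch goal with
  | |- @eq ?T ?a ?b =>
      let l0 := ZmodNorm.collect (@nil T) a in
      let l := ZmodNorm.collect l0 b in
      let a' := ZmodNorm.reify l a in
      let b' := ZmodNorm.reify l b in
      apply: (@ZmodNorm.correct _ l a' b'); vm_compute; reflexivity
  end.

Lemma trilinear_simp (K : fieldType) (A : lmodType K) (f : ternary_op A) :
  trilinear f ->
  ((forall x x' y z : A, f (x + x')%R y z = (f x y z + f x' y z)%R)
   * (forall x y y' z : A, f x (y + y')%R z = (f x y z + f x y' z)%R)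
   * (forall x y z z' : A, f x y (z + z')%R = (f x y z + f x y z')%R)
   * (forall x y z : A, f (- x)%R y z = (- f x y z)%R)
   * (forall x y z : A, f x (- y)%R z = (- f x y z)%R)
   * (forall x y z : A, f x y (- z)%R = (- f x y z)%R))%type.
Proof.
have lin (g : A -> A) : linear g ->
    (forall u v, g (u + v) = g u + g v) /\ (forall u, g (- u) = - g u).
  move=> lg; have gD u v : g (u + v) = g u + g v.
    by have := lg 1 u v; rewrite !scale1r.
  split=> // u; apply/eqP; rewrite -subr_eq0 opprK -gD addNr.
  by have := gD 0 0; rewrite addr0 => /eqP; rewrite addrC -subr_eq subrr eq_sym.
case=> l1 l2 l3; do !split=> *.
- exact: (lin _ (l1 _ _)).1.
- exact: (lin _ (l2 _ _)).1.
- exact: (lin _ (l3 _ _)).1.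
- exact: (lin _ (l1 _ _)).2.
- exact: (lin _ (l2 _ _)).2.
- exact: (lin _ (l3 _ _)).2.
Qed.

Lemma trilinear_add (K : fieldType) (A : lmodType K) (f g : ternary_op A) :
  trilinear f -> trilinear g -> trilinear (fun x y z => f x y z + g x y z).
Proof.
by case=> [f1 f2 f3] [g1 g2 g3]; split=> u v a x y;
  rewrite ?f1 ?f2 ?f3 ?g1 ?g2 ?g3 scalerDr addrACA.
Qed.

Lemma trilinear_opp (K : fieldType) (A : lmodType K) (f : ternary_op A) :
  trilinear f -> trilinear (fun x y z => - f x y z).
Proof.
by case=> [f1 f2 f3]; split=> u v a x y;
  rewrite ?f1 ?f2 ?f3 opprD scalerN.
Qed.

Lemma trilinear_cycle (K : fieldType) (A : lmodType K) (f : ternary_op A) :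
  trilinear f -> trilinear (fun x y z => f z x y).
Proof. by case=> f1 f2 f3; split=> u v; [exact: f2|exact: f3|exact: f1]. Qed.

Lemma trilinear_swap (K : fieldType) (A : lmodType K) (f : ternary_op A) :
  trilinear f -> trilinear (fun x y z => f y x z).
Proof. by case=> f1 f2 f3; split=> u v; [exact: f2|exact: f1|exact: f3]. Qed.

Lemma trilinear_cyclic_sum (K : fieldType) (A : lmodType K) (f : ternary_op A) :
  trilinear f -> trilinear (cyclic_sum f).
Proof.
move=> fl; have fl1 := trilinear_cycle fl; have fl2 := trilinear_cycle fl1.
exact: trilinear_add (trilinear_add fl fl2) fl1.
Qed.

Lemma hbracket_trilinear (K : fieldType) (A : lmodType K) (nw ne : ternary_op A) :
  trilinear nw -> trilinear ne -> trilinear (hbracket nw ne).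
Proof.
move=> wl el.
exact: trilinear_add (trilinear_add wl el) (trilinear_opp (trilinear_swap el)).
Qed.

Lemma vbracket_trilinear (K : fieldType) (A : lmodType K) (nw ne : ternary_op A) :
  trilinear nw -> trilinear ne -> trilinear (vbracket nw ne).
Proof.
move=> wl el; have el1 := trilinear_cycle el.
exact: trilinear_add (trilinear_add wl el1) (trilinear_opp (trilinear_swap el1)).
Qed.

Lemma Cbracket_vE (A : zmodType) (nw ne : ternary_op A) (x y z : A) :
  Cbracket nw ne x y z = cyclic_sum (vbracket nw ne) x y z.
Proof. rewrite /Cbracket /cyclic_sum /hbracket /vbracket; zmod_eq. Qed.

Section PreLieToLie.

Variables (K : fieldType) (A : lmodType K) (P : hom3PreLieAlgebra A).

Let b := pl_br P.
Let al := pl_alpha P.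
Let bE := trilinear_simp (pl_trilinear P : trilinear b).
Let skew : forall x y z, b x y z = - b y x z := pl_skew P.
Let ax1 : forall x1 x2 x3 x4 x5,
  b (al x1) (al x2) (b x3 x4 x5) =
    b (cyclic_sum b x1 x2 x3) (al x4) (al x5)
    + b (al x3) (cyclic_sum b x1 x2 x4) (al x5)
    + b (al x3) (al x4) (b x1 x2 x5) := pl_ax1 P.
Let ax2 : forall x1 x2 x3 x4 x5,
  b (cyclic_sum b x1 x2 x3) (al x4) (al x5) =
    cyclic_sum (fun u v w => b (al u) (al v) (b w x4 x5)) x1 x2 x3 := pl_ax2 P.

Lemma preLie_mult : multiplicative3 (cyclic_sum b) al.
Proof. by move=> x y z; rewrite /cyclic_sum !raddfD /= !(pl_mult P). Qed.

Lemma preLie_skew12 x y z : cyclic_sum b x y z = - cyclic_sum b y x z.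
Proof.
by rewrite /cyclic_sum (skew x y z) (skew y z x) (skew z x y); zmod_eq.
Qed.

Lemma preLie_skew23 x y z : cyclic_sum b x y z = - cyclic_sum b x z y.
Proof.
by rewrite /cyclic_sum (skew x y z) (skew y z x) (skew z x y); zmod_eq.
Qed.

Lemma preLie_hom_nambu x1 x2 x3 x4 x5 :
  cyclic_sum b (al x1) (al x2) (cyclic_sum b x3 x4 x5) =
    cyclic_sum b (cyclic_sum b x1 x2 x3) (al x4) (al x5)
    + cyclic_sum b (al x3) (cyclic_sum b x1 x2 x4) (al x5)
    + cyclic_sum b (al x3) (al x4) (cyclic_sum b x1 x2 x5).
Proof.
apply: (ZmodNorm.use (ax1 x1 x2 x3 x4 x5)).
apply: (ZmodNorm.use (ax1 x1 x2 x4 x5 x3)).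
apply: (ZmodNorm.use (ax1 x1 x2 x5 x3 x4)).
apply: (ZmodNorm.use (ax2 x3 x4 x5 x1 x2)).
apply: (ZmodNorm.use (esym (ax2 x3 x4 x5 x2 x1))).
rewrite /cyclic_sum.
move: (al x1) (al x2) (al x3) (al x4) (al x5) => y1 y2 y3 y4 y5.
rewrite !bE !(skew _ y1) !(skew _ y2) !(skew _ x1) !(skew _ x2) !bE.
zmod_eq.
Qed.

Definition subadjacent_Lie : hom3LieAlgebra A :=
  Hom3LieAlgebra (trilinear_cyclic_sum (pl_trilinear P))
    preLie_mult preLie_skew12 preLie_skew23 preLie_hom_nambu.

End PreLieToLie.

Section LDendriformToPreLie.

Variables (K : fieldType) (A : lmodType K) (D : hom3LDendriformAlgebra A).

Let nw := ld_nw D.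
Let ne := ld_ne D.
Let al := ld_alpha D.
Let h := hbracket nw ne.
Let v := vbracket nw ne.
Let C := Cbracket nw ne.
Let wE := trilinear_simp (ld_nw_trilinear D : trilinear nw).
Let eE := trilinear_simp (ld_ne_trilinear D : trilinear ne).

Let skew x y z : nw x y z = - nw y x z.
Proof. by apply/eqP; rewrite -addr_eq0; apply/eqP; exact: ld_ax0. Qed.
Let ax1 : forall x1 x2 x3 x4 x5,
  nw (al x1) (al x2) (nw x3 x4 x5) - nw (al x3) (al x4) (nw x1 x2 x5) =
  nw (C x1 x2 x3) (al x4) (al x5) - nw (C x1 x2 x4) (al x3) (al x5)
  := ld_ax1 D.
Let ax2 : forall x1 x2 x3 x4 x5,
  nw (al x1) (al x2) (ne x5 x3 x4) - ne (al x5) (al x3) (h x1 x2 x4) =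
  ne (al x5) (C x1 x2 x3) (al x4) + ne (v x1 x2 x5) (al x3) (al x4)
  := ld_ax2 D.
Let ax3 : forall x1 x2 x3 x4 x5,
  ne (al x5) (al x1) (h x2 x3 x4) - nw (al x2) (al x3) (ne x5 x1 x4) =
  ne (v x1 x2 x5) (al x3) (al x4) - ne (v x1 x3 x5) (al x2) (al x4)
  := ld_ax3 D.
Let ax4 : forall x1 x2 x3 x4 x5,
  nw (C x1 x2 x3) (al x4) (al x5) =
  cyclic_sum (fun a b c => nw (al a) (al b) (nw c x4 x5)) x1 x2 x3
  := ld_ax4 D.
Let ax5 : forall x1 x2 x3 x4 x5,
  ne (al x5) (C x1 x2 x3) (al x4) =
  cyclic_sum (fun a b c => nw (al a) (al b) (ne x5 c x4)) x1 x2 x3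
  := ld_ax5 D.
Let ax6 : forall x1 x2 x3 x4 x5,
  nw (al x1) (al x2) (ne x5 x3 x4) + ne (al x5) (al x1) (h x2 x3 x4) =
  ne (al x5) (al x2) (h x1 x3 x4) + ne (v x1 x2 x5) (al x3) (al x4)
  := ld_ax6 D.

Lemma hbracket_mult : multiplicative3 h al.
Proof.
move=> x y z; rewrite /h /hbracket raddfB raddfD /=.
by rewrite (ld_nw_mult D) !(ld_ne_mult D).
Qed.

Lemma vbracket_mult : multiplicative3 v al.
Proof.
move=> x y z; rewrite /v /vbracket raddfB raddfD /=.
by rewrite (ld_nw_mult D) !(ld_ne_mult D).
Qed.

Lemma hbracket_skew x y z : h x y z = - h y x z.
Proof. by rewrite /h /hbracket (skew x); zmod_eq. Qed.

Lemma vbracket_skew x y z : v x y z = - v y x z.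
Proof. by rewrite /v /vbracket (skew x); zmod_eq. Qed.

Lemma hbracket_preLie1 x1 x2 x3 x4 x5 :
  h (al x1) (al x2) (h x3 x4 x5) =
    h (cyclic_sum h x1 x2 x3) (al x4) (al x5)
    + h (al x3) (cyclic_sum h x1 x2 x4) (al x5)
    + h (al x3) (al x4) (h x1 x2 x5).
Proof.
apply: (ZmodNorm.use (ax1 x1 x2 x3 x4 x5)).
apply: (ZmodNorm.use (ax2 x1 x2 x4 x5 x3)).
apply: (ZmodNorm.use (esym (ax2 x1 x2 x3 x5 x4))).
apply: (ZmodNorm.use (ax3 x2 x3 x4 x5 x1)).
apply: (ZmodNorm.use (esym (ax3 x1 x3 x4 x5 x2))).
rewrite /C /Cbracket -/h /cyclic_sum.
move: (al x1) (al x2) (al x3) (al x4) (al x5) => y1 y2 y3 y4 y5.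
rewrite /h /v /hbracket /vbracket !wE !eE.
rewrite !(skew y3) !(skew _ x1) !(skew _ x2).
rewrite !wE !eE; zmod_eq.
Qed.

Lemma hbracket_preLie2 x1 x2 x3 x4 x5 :
  h (cyclic_sum h x1 x2 x3) (al x4) (al x5) =
    cyclic_sum (fun a b c => h (al a) (al b) (h c x4 x5)) x1 x2 x3.
Proof.
apply: (ZmodNorm.use (ax4 x1 x2 x3 x4 x5)).
apply: (ZmodNorm.use (esym (ax5 x1 x2 x3 x5 x4))).
apply: (ZmodNorm.use (esym (ax6 x1 x2 x4 x5 x3))).
apply: (ZmodNorm.use (esym (ax6 x2 x3 x4 x5 x1))).
apply: (ZmodNorm.use (esym (ax6 x3 x1 x4 x5 x2))).
rewrite /C /Cbracket -/h /cyclic_sum.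
move: (al x1) (al x2) (al x3) (al x4) (al x5) => y1 y2 y3 y4 y5.
rewrite /h /v /hbracket /vbracket !wE !eE; zmod_eq.
Qed.

Lemma vbracket_preLie1 x1 x2 x3 x4 x5 :
  v (al x1) (al x2) (v x3 x4 x5) =
    v (cyclic_sum v x1 x2 x3) (al x4) (al x5)
    + v (al x3) (cyclic_sum v x1 x2 x4) (al x5)
    + v (al x3) (al x4) (v x1 x2 x5).
Proof.
apply: (ZmodNorm.use (ax1 x1 x2 x3 x4 x5)).
apply: (ZmodNorm.use (ax2 x1 x2 x3 x4 x5)).
apply: (ZmodNorm.use (esym (ax2 x1 x2 x4 x3 x5))).
apply: (ZmodNorm.use (esym (ax6 x3 x4 x1 x2 x5))).
apply: (ZmodNorm.use (ax6 x3 x4 x2 x1 x5)).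
rewrite /C /Cbracket -/h /cyclic_sum.
move: (al x1) (al x2) (al x3) (al x4) (al x5) => y1 y2 y3 y4 y5.
rewrite /h /v /hbracket /vbracket !wE !eE.
rewrite !(skew y3) !(skew _ x1) !(skew _ x2).
rewrite !wE !eE; zmod_eq.
Qed.

Lemma vbracket_preLie2 x1 x2 x3 x4 x5 :
  v (cyclic_sum v x1 x2 x3) (al x4) (al x5) =
    cyclic_sum (fun a b c => v (al a) (al b) (v c x4 x5)) x1 x2 x3.
Proof.
apply: (ZmodNorm.use (ax4 x1 x2 x3 x4 x5)).
apply: (ZmodNorm.use (ax5 x1 x2 x3 x4 x5)).
apply: (ZmodNorm.use (esym (ax3 x4 x1 x2 x3 x5))).
apply: (ZmodNorm.use (esym (ax3 x4 x2 x3 x1 x5))).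
apply: (ZmodNorm.use (esym (ax3 x4 x3 x1 x2 x5))).
rewrite /C /Cbracket -/h /cyclic_sum.
move: (al x1) (al x2) (al x3) (al x4) (al x5) => y1 y2 y3 y4 y5.
rewrite /h /v /hbracket /vbracket !wE !eE.
rewrite !(skew x4) !eE; zmod_eq.
Qed.

Definition subadjacent_hPreLie : hom3PreLieAlgebra A :=
  Hom3PreLieAlgebra (hbracket_trilinear (ld_nw_trilinear D) (ld_ne_trilinear D))
    hbracket_mult hbracket_skew hbracket_preLie1 hbracket_preLie2.

Definition subadjacent_vPreLie : hom3PreLieAlgebra A :=
  Hom3PreLieAlgebra (vbracket_trilinear (ld_nw_trilinear D) (ld_ne_trilinear D))
    vbracket_mult vbracket_skew vbracket_preLie1 vbracket_preLie2.

(* Its bracket is the cyclic sum of [hbracket], i.e. [Cbracket]. *)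
Definition subadjacent_CLie : hom3LieAlgebra A :=
  subadjacent_Lie subadjacent_hPreLie.

End LDendriformToPreLie.

Lemma subadjacent_hPreLie_brE (K : fieldType) (A : lmodType K)
    (D : hom3LDendriformAlgebra A) :
  pl_br (subadjacent_hPreLie D) = hbracket (ld_nw D) (ld_ne D).
Proof. by []. Qed.

Lemma subadjacent_vPreLie_brE (K : fieldType) (A : lmodType K)
    (D : hom3LDendriformAlgebra A) :
  pl_br (subadjacent_vPreLie D) = vbracket (ld_nw D) (ld_ne D).
Proof. by []. Qed.

Lemma subadjacent_CLie_brE (K : fieldType) (A : lmodType K)
    (D : hom3LDendriformAlgebra A) :
  lie_br (subadjacent_CLie D) = Cbracket (ld_nw D) (ld_ne D).
Proof. by []. Qed.

(* Main.v *)
(* The Nijenhuis identity is additive in the operation and invariant under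
   permutations of its arguments, and each of the three brackets is a signed sum
   of argument permutations of the two dendriform operations. *)
Require Import Defs.
From mathcomp Require Import all_boot all_algebra.

Import GRing.Theory.
Local Open Scope ring_scope.

(** Since [N] is additive, so are its iterates, and the right-hand side splits into an [f] part and
    a [g] part. *)
Lemma nijenhuis_add {A : zmodType} {f g : ternary_op A} {N : {additive A -> A}} :
  nijenhuis_identity f N -> nijenhuis_identity g N ->
  nijenhuis_identity (fun x y z => f x y z + g x y z) N.
Proof. by move=> Nf Ng x y z; rewrite Nf Ng !raddfD; zmod_eq. Qed.

Lemma nijenhuis_opp {A : zmodType} {f : ternary_op A} {N : {additive A -> A}} :
  nijenhuis_identity f N -> nijenhuis_identity (fun x y z => - f x y z) N.
Proof. by move=> Nf x y z; rewrite Nf !(raddfD N, raddfN N); zmod_eq. Qed.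

(** The terms with a given number of arguments under [N] run over all choices of positions, so
    permuting the arguments only reorders summands within each group. *)
Lemma nijenhuis_cycle {A : zmodType} {f : ternary_op A} {N : {additive A -> A}} :
  nijenhuis_identity f N -> nijenhuis_identity (fun x y z => f z x y) N.
Proof. by move=> Nf x y z; rewrite Nf !raddfD; zmod_eq. Qed.

Lemma nijenhuis_swap {A : zmodType} {f : ternary_op A} {N : {additive A -> A}} :
  nijenhuis_identity f N -> nijenhuis_identity (fun x y z => f y x z) N.
Proof. by move=> Nf x y z; rewrite Nf !raddfD; zmod_eq. Qed.

Lemma nijenhuis_cyclic_sum {A : zmodType} {f : ternary_op A} {N : {additive A -> A}} :
  nijenhuis_identity f N -> nijenhuis_identity (cyclic_sum f) N.
Proof.
move=> Nf; have Nf1 := nijenhuis_cycle Nf; have Nf2 := nijenhuis_cycle Nf1.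
(* [Nf1] concerns [f z x y] and [Nf2] concerns [f y z x], hence this order. *)
exact: nijenhuis_add (nijenhuis_add Nf Nf2) Nf1.
Qed.

Lemma nijenhuis_hbracket {A : zmodType} {nw ne : ternary_op A} {N : {additive A -> A}} :
  nijenhuis_identity nw N -> nijenhuis_identity ne N ->
  nijenhuis_identity (hbracket nw ne) N.
Proof.
move=> Nw Ne.
exact: nijenhuis_add (nijenhuis_add Nw Ne) (nijenhuis_opp (nijenhuis_swap Ne)).
Qed.

Lemma nijenhuis_vbracket {A : zmodType} {nw ne : ternary_op A} {N : {additive A -> A}} :
  nijenhuis_identity nw N -> nijenhuis_identity ne N ->
  nijenhuis_identity (vbracket nw ne) N.
Proof.
move=> Nw Ne; have Ne1 := nijenhuis_cycle Ne.
(* Swapping the first two arguments in the rotated [ne z x y] gives [ne z y x]. *)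
exact: nijenhuis_add (nijenhuis_add Nw Ne1) (nijenhuis_opp (nijenhuis_swap Ne1)).
Qed.

Theorem proposition4p3 (K : fieldType) (charK0 : [pchar K] =i pred0)
    (A : lmodType K) (D : hom3LDendriformAlgebra A) (N : {linear A -> A})
    (hN : LDendriform_Nijenhuis D N) :
  [/\ PreLie_Nijenhuis (subadjacent_hPreLie D) N,
      PreLie_Nijenhuis (subadjacent_vPreLie D) N
    & Lie_Nijenhuis (subadjacent_CLie D) N].
Proof.
case: hN => Nalpha Nw Ne.
(* All three sub-adjacent structures carry the twisting map of [D], so [Nalpha] settles each
   commutation condition by conversion. *)
split; split; try exact: Nalpha.
- exact: nijenhuis_hbracket Nw Ne.
- exact: nijenhuis_vbracket Nw Ne.
- exact: nijenhuis_cyclic_sum (nijenhuis_hbracket Nw Ne).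
Qed.
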